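(* Let $X$ be a real Hilbert space, let $\gamma>0$, let $\tilde u_0,\tilde v_0\in X$, and let $\tilde C_\gamma=\{(\tilde u,\tilde v)\in X\times X : \|\tilde u\|^2-\|\tilde v\|^2=2\gamma\}$. Then the following hold. (i) When $\tilde u_0\neq 0$ and $\tilde v_0\neq 0$, $$P_{\tilde C_\gamma}(\tilde u_0,\tilde v_0)=\left\{\left(\frac{\tilde u_0}{1+\lambda},\ \frac{\tilde v_0}{1-\lambda}\right)\right\},$$ where $\lambda$ is the unique root of $H(\lambda)=0$ in the open interval $(-1,1)$, with $$H(\lambda)=\frac{(\lambda^2+1)p-2\lambda q}{2(1-\lambda^2)^2}-\gamma,\qquad p=\|\tilde u_0\|^2-\|\tilde v_0\|^2,\qquad q=\|\tilde u_0\|^2+\|\tilde v_0\|^2.$$ (ii) When $\tilde u_0=0$, $$P_{\tilde C_\gamma}(0,\tilde v_0)=\left\{\left(\tilde u,\ \frac{\tilde v_0}{2}\right) : \tilde u\in X,\ \|\tilde u\|^2=2\gamma+\frac{\|\tilde v_0\|^2}{4}\right\}.$$ (iii) a) When $\tilde v_0=0$ and $\|\tilde u_0\|\ge 2\sqrt{2\gamma}$, $$P_{\tilde C_\gamma}(\tilde u_0,0)=\left\{\left(\frac{\tilde u_0}{2},\ \tilde v\right) : \tilde v\in X,\ \|\tilde v\|^2=\frac{\|\tilde u_0\|^2}{4}-2\gamma\right\}.$$ b) When $\tilde v_0=0$ and $0<\|\tilde u_0\|<2\sqrt{2\gamma}$, $$P_{\tilde C_\gamma}(\tilde u_0,0)=\left\{\left(\sqrt{2\gamma}\,\frac{\tilde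 u_0}{\|\tilde u_0\|},\ 0\right)\right\}.$$
   Context: $X$ is a real Hilbert space with induced norm $\|\cdot\|$. The product $X\times X$ carries the norm $\|(u,v)\|^2=\|u\|^2+\|v\|^2$. For a set $S\subseteq X\times X$ and a point $z\in X\times X$, $P_S(z)$ denotes the (possibly empty, possibly multi-valued) set of nearest points: $P_S(z)=\{s\in S : \|z-s\|\le\|z-s'\|\text{ for all }s'\in S\}$. *)

(* Defs.v *)
From mathcomp Require Import all_boot all_order all_algebra.
From mathcomp Require Import all_classical all_reals all_analysis.
Set Implicit Arguments.
Unset Strict Implicit.
Unset Printing Implicit Defensive.
Import Order.TTheory GRing.Theory Num.Theory numFieldNormedType.Exports.

Local Open Scope ring_scope.
Local Open Scope classical_set_scope.

(* The Hilbert norm on X * X; the canonical norm that the library puts on a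
   product is the max norm, so it cannot be used here. *)
Definition pair_norm (R : realType) (X : normedModType R) (z : X * X) : R :=
  Num.sqrt (`|z.1| ^+ 2 + `|z.2| ^+ 2).

(* Nearest points of S to z; possibly empty, possibly multi-valued. *)
Definition nearest_points (R : realType) (X : normedModType R) (S : set (X * X))
    (z : X * X) : set (X * X) :=
  [set s | S s /\ forall s', S s' -> pair_norm (z - s) <= pair_norm (z - s')].

Definition Cset (R : realType) (X : normedModType R) (gamma : R) :
    set (X * X) :=
  [set z | `|z.1| ^+ 2 - `|z.2| ^+ 2 = 2 * gamma].

Definition Hfun (R : realType) (gamma p q lambda : R) : R :=
  ((lambda ^+ 2 + 1) * p - 2 * lambda * q) / (2 * (1 - lambda ^+ 2) ^+ 2)
  - gamma.

(* Main.v *)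
Require Import Defs.
From mathcomp Require Import all_boot all_order all_algebra.
From mathcomp Require Import all_classical all_reals all_analysis.
From mathcomp Require Import ring lra.
Import Order.TTheory GRing.Theory Num.Theory numFieldNormedType.Exports.

Local Open Scope ring_scope.
Local Open Scope classical_set_scope.

(** The projection is a quadratic minimisation under one quadratic constraint,
    and the Lagrangian already decides it.  Take a multiplier lambda in the
    closed interval [-1, 1] and a point (a, b) of the hyperbola that is critical
    for lambda, meaning that the point z to be projected is
    ((1 + lambda) a, (1 - lambda) b).  On the hyperbola the term
    lambda (|u|^2 - |v|^2) is constant, so completing squares gives, for every
    (u, v) there,
      |z - (u, v)|^2 = |z - (a, b)|^2
                       + (1 + lambda) |u - a|^2 + (1 - lambda) |v - b|^2.
    Both weights are nonnegative.  Hence (a, b) is nearest, and the nearest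
    points are exactly the points of the hyperbola at which both weighted terms
    vanish ([nearest_points_CsetE]).  No existence theorem for minimisers is
    involved: one critical point with a multiplier in [-1, 1] is enough.

    The cases differ only in the multiplier.  If u0 and v0 are both nonzero,
    a = u0 / (1 + lambda) and b = v0 / (1 - lambda), and lying on the hyperbola
    means H(lambda) = 0; a root in (-1, 1) exists by the intermediate value
    theorem ([Hfun_root_exists]).  It is unique because each root describes the
    same singleton of nearest points, whose first component u0 / (1 + lambda)
    determines lambda.  If u0 = 0 the multiplier is -1: the first weight
    vanishes, which leaves u free on a sphere.  If v0 = 0 and u0 is long the
    multiplier is 1, and v is free.  If v0 = 0 and u0 is short, that sphere for
    v would have negative squared radius; instead b = 0 and the multiplier
    |u0| / sqrt (2 gamma) - 1 lies in (-1, 1). *)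

Set Implicit Arguments.
Unset Strict Implicit.

Lemma sqr_norm_dot (R : realType) (X : normedModType R)
    (dot : {dot X for idfun})
    (norm_dot : forall x : X, `|x| = Num.sqrt (dot x x)) (x : X) :
  `|x| ^+ 2 = dot x x.
Proof.
have [->|x0] := eqVneq x 0; first by rewrite linear0l normr0 expr0n.
by rewrite norm_dot sqr_sqrtr// ltW// neq0_dnorm_gt0.
Qed.

(** Completing the square.  With c = 1 + lambda and with c = 1 - lambda, the
    coefficients 1 - c of |x|^2 are opposite, so in the sum of the two
    identities only the constraint |u|^2 - |v|^2 appears. *)
Lemma sqr_norm_scaleB (R : realType) (X : normedModType R)
    (dot : {dot X for idfun})
    (norm_dot : forall x : X, `|x| = Num.sqrt (dot x x)) (c : R) (a x : X) :
  `|c *: a - x| ^+ 2 =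
  (1 - c) * `|x| ^+ 2 + c * `|x - a| ^+ 2 - c * (1 - c) * `|a| ^+ 2.
Proof.
have sym : dot a x = dot x a by rewrite hermC expr0 mul1r.
have expandB (y z : X) :
    `|y - z| ^+ 2 = `|y| ^+ 2 - dot y z - (dot z y - `|z| ^+ 2).
  by rewrite !(sqr_norm_dot norm_dot) linearBl !linearBr addrAC opprB.
rewrite !expandB !(sqr_norm_dot norm_dot).
have dotZl (y : X) : dot (c *: a) y = c * dot a y by rewrite linearZl_LR.
have dotZr (y : X) : dot y (c *: a) = c * dot y a by rewrite linearZr_LR.
rewrite !(dotZl, dotZr) sym.
ring.
Qed.

Lemma sqr_pair_norm (R : realType) (X : normedModType R) (z : X * X) :
  pair_norm z ^+ 2 = `|z.1| ^+ 2 + `|z.2| ^+ 2.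
Proof. by rewrite /pair_norm sqr_sqrtr// addr_ge0// sqr_ge0. Qed.

Lemma sqr_normZ (R : realType) (X : normedModType R) (c : R) (x : X) :
  `|c *: x| ^+ 2 = c ^+ 2 * `|x| ^+ 2.
Proof. by rewrite normrZ exprMn real_normK// num_real. Qed.

(** Supplies a critical point when the multiplier is 1 or -1, where one
    component is constrained only by its norm. *)
Lemma exists_sqr_norm (R : realType) (X : normedModType R) (x : X) (t : R) :
  x != 0 -> 0 <= t -> exists y : X, `|y| ^+ 2 = t.
Proof.
move=> x0 t0; exists ((Num.sqrt t / `|x|) *: x).
by rewrite sqr_normZ -exprMn divfK ?normr_eq0// sqr_sqrtr.
Qed.

(** When u0 = 0, the only source of a nonzero vector is a point of the hyperbola
    itself; if X is trivial the hyperbola is empty. *)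
Lemma Cset_fst_neq0 (R : realType) (X : normedModType R) (gamma : R)
    (s : X * X) : 0 < gamma -> Cset gamma s -> s.1 != 0.
Proof.
move=> g0; rewrite /Cset/= => Cs; apply: contraPneq Cs => ->.
rewrite normr0; have := sqr_ge0 `|s.2|; move=> ? ?; lra.
Qed.

(** The Lagrangian identity: the distance to a point s of the hyperbola exceeds
    the distance to a critical point (a, b) by a weighted sum of squares. *)
Lemma pair_norm_excess (R : realType) (X : normedModType R)
    (dot : {dot X for idfun})
    (norm_dot : forall x : X, `|x| = Num.sqrt (dot x x))
    (gamma lambda : R) (a b : X) (s : X * X) :
  Cset gamma (a, b) -> Cset gamma s ->
  let z := ((1 + lambda) *: a, (1 - lambda) *: b) in
  pair_norm (z - s) ^+ 2 = pair_norm (z - (a, b)) ^+ 2 +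
    ((1 + lambda) * `|s.1 - a| ^+ 2 + (1 - lambda) * `|s.2 - b| ^+ 2).
Proof.
rewrite /Cset/= => Cab Cs; rewrite !sqr_pair_norm/=.
rewrite !(sqr_norm_scaleB norm_dot) !subrr !normr0.
have -> : `|s.2| ^+ 2 = `|s.1| ^+ 2 - 2 * gamma by lra.
have -> : `|b| ^+ 2 = `|a| ^+ 2 - 2 * gamma by lra.
ring.
Qed.

(** The endpoints -1 and 1 are included on purpose: there one weight is zero and
    the corresponding component of a nearest point is not determined. *)
Lemma nearest_points_CsetE (R : realType) (X : normedModType R)
    (dot : {dot X for idfun})
    (norm_dot : forall x : X, `|x| = Num.sqrt (dot x x))
    (gamma lambda : R) (a b : X) :
  -1 <= lambda <= 1 -> Cset gamma (a, b) ->
  nearest_points (Cset gamma) ((1 + lambda) *: a, (1 - lambda) *: b) =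
  [set s | [/\ Cset gamma s, (1 + lambda) *: (s.1 - a) = 0
             & (1 - lambda) *: (s.2 - b) = 0]].
Proof.
move=> /andP[l1 l2] Cab; set z := (_ *: a, _ *: b).
have excess s (Cs : Cset gamma s) := pair_norm_excess norm_dot lambda Cab Cs.
have ge1 (s : X * X) : 0 <= (1 + lambda) * `|s.1 - a| ^+ 2.
  by rewrite mulr_ge0 ?sqr_ge0//; lra.
have ge2 (s : X * X) : 0 <= (1 - lambda) * `|s.2 - b| ^+ 2.
  by rewrite mulr_ge0 ?sqr_ge0//; lra.
have le_sqr (x y : X * X) :
    (pair_norm x <= pair_norm y) = (pair_norm x ^+ 2 <= pair_norm y ^+ 2).
  by rewrite ler_sqr// nnegrE sqrtr_ge0.
have wt0 (c : R) (x : X) : (c *: x == 0) = (c * `|x| ^+ 2 == 0).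
  by rewrite scaler_eq0 mulf_eq0 sqrf_eq0 normr_eq0.
apply/seteqP; split=> s /=.
- move=> [Cs] /(_ _ Cab); rewrite le_sqr (excess _ Cs) => le.
  by split=> //; apply/eqP; rewrite wt0; apply/eqP;
    have := ge1 s; have := ge2 s; lra.
- move=> [Cs /eqP e1 /eqP e2]; split=> // s' Cs'.
  rewrite le_sqr (excess _ Cs) (excess _ Cs').
  move: e1 e2; rewrite !wt0 => /eqP-> /eqP->.
  by have := ge1 s'; have := ge2 s'; lra.
Qed.

(** For a multiplier strictly inside the interval both weights are positive, so
    the excess vanishes at one point only. *)
Lemma nearest_points_Cset1 (R : realType) (X : normedModType R)
    (dot : {dot X for idfun})
    (norm_dot : forall x : X, `|x| = Num.sqrt (dot x x))
    (gamma lambda : R) (a b : X) :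
  -1 < lambda < 1 -> Cset gamma (a, b) ->
  nearest_points (Cset gamma) ((1 + lambda) *: a, (1 - lambda) *: b) =
  [set (a, b)].
Proof.
move=> /andP[l1 l2] Cab; rewrite (nearest_points_CsetE norm_dot)//; last lra.
have c1 : (1 + lambda == 0) = false by apply/eqP; lra.
have c2 : (1 - lambda == 0) = false by apply/eqP; lra.
apply/seteqP; split=> [[u v]|_ ->]/=; last by rewrite !subrr !scaler0.
move=> [_ /eqP + /eqP]; rewrite !scaler_eq0 c1 c2 !subr_eq0/=.
by move=> /eqP-> /eqP->.
Qed.

(** In this form, with A = |u0|^2 and B = |v0|^2, the equation H(l) = 0 visibly
    says that (u0 / (1 + l), v0 / (1 - l)) satisfies the constraint. *)
Lemma HfunE (R : realType) (gamma A B l : R) : -1 < l < 1 ->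
  Hfun gamma (A - B) (A + B) l =
  (A / (1 + l) ^+ 2 - B / (1 - l) ^+ 2) / 2 - gamma.
Proof.
move=> /andP[l1 l2]; rewrite /Hfun.
have n1 : 1 + l != 0 by apply/eqP; lra.
have n2 : 1 - l != 0 by apply/eqP; lra.
have n3 : 1 - l ^+ 2 != 0 by apply/eqP; nra.
by field; rewrite n1 n2 n3.
Qed.

(** Clearing denominators in - H turns the poles at -1 and 1 into sign
    conditions: the resulting polynomial takes the value - 4 A at -1 and 4 B
    at 1, so it has a root, and neither endpoint is one. *)
Lemma Hfun_root_exists (R : realType) (gamma A B : R) : 0 < A -> 0 < B ->
  exists2 l : R, -1 < l < 1 & Hfun gamma (A - B) (A + B) l = 0.
Proof.
move=> A0 B0.
pose P : {poly R} := B%:P * (1 + 'X) ^+ 2 - A%:P * (1 - 'X) ^+ 2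
                     + (2 * gamma)%:P * (1 - 'X ^+ 2) ^+ 2.
have PE l : P.[l] = B * (1 + l) ^+ 2 - A * (1 - l) ^+ 2
                    + 2 * gamma * (1 - l ^+ 2) ^+ 2 by rewrite /P !hornerE.
have [||l /andP[l1 l2] /rootP] := @poly_ivt R P (-1) 1.
- lra.
- by rewrite !PE; apply/andP; split; nra.
rewrite PE => Pl.
have l1' : l != -1 by apply: contraPneq Pl => ->; nra.
have l2' : l != 1 by apply: contraPneq Pl => ->; nra.
have lin : -1 < l < 1 by rewrite !lt_neqAle l1 l2 l2' eq_sym l1'.
exists l => //; rewrite HfunE//; case/andP: lin => l3 l4.
have n1 : 1 + l != 0 by apply/eqP; lra.
have n2 : 1 - l != 0 by apply/eqP; lra.
suff -> : (A / (1 + l) ^+ 2 - B / (1 - l) ^+ 2) / 2 - gamma =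
  - (B * (1 + l) ^+ 2 - A * (1 - l) ^+ 2 + 2 * gamma * (1 - l ^+ 2) ^+ 2) /
    (2 * (1 + l) ^+ 2 * (1 - l) ^+ 2) by rewrite Pl oppr0 mul0r.
by field; rewrite n1 n2.
Qed.

Lemma Hfun_root_Cset (R : realType) (X : normedModType R) (gamma l : R)
    (u v : X) : -1 < l < 1 ->
  Hfun gamma (`|u| ^+ 2 - `|v| ^+ 2) (`|u| ^+ 2 + `|v| ^+ 2) l = 0 ->
  Cset gamma ((1 + l)^-1 *: u, (1 - l)^-1 *: v).
Proof.
move=> lin; rewrite HfunE// /Cset/= !sqr_normZ !exprVn => H.
lra.
Qed.

Unset Implicit Arguments.
Set Strict Implicit.

Theorem theorem3p9 (R : realType) (X : completeNormedModType R)
    (dot : {dot X for idfun})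
    (norm_dot : forall x : X, `|x| = Num.sqrt (dot x x))
    (gamma : R) (gamma_gt0 : 0 < gamma) (u0 v0 : X) :
  (* (i) *)
  (u0 != 0 -> v0 != 0 ->
    let p : R := `|u0| ^+ 2 - `|v0| ^+ 2 in
    let q : R := `|u0| ^+ 2 + `|v0| ^+ 2 in
    exists lambda : R,
      unique (fun l : R => -1 < l < 1 /\ Hfun gamma p q l = 0) lambda /\
      nearest_points (Cset gamma) (u0, v0) =
        [set ((1 + lambda)^-1 *: u0, (1 - lambda)^-1 *: v0)]) /\
  (* (ii) *)
  (u0 = 0 ->
    nearest_points (Cset gamma) (0, v0) =
      [set (u, 2^-1 *: v0) | u in
        [set u : X | `|u| ^+ 2 = 2 * gamma + `|v0| ^+ 2 / 4]]) /\
  (* (iii) a) *)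
  (v0 = 0 -> 2 * Num.sqrt (2 * gamma) <= `|u0| ->
    nearest_points (Cset gamma) (u0, 0) =
      [set (2^-1 *: u0, v) | v in
        [set v : X | `|v| ^+ 2 = `|u0| ^+ 2 / 4 - 2 * gamma]]) /\
  (* (iii) b) *)
  (v0 = 0 -> 0 < `|u0| < 2 * Num.sqrt (2 * gamma) ->
    nearest_points (Cset gamma) (u0, 0) =
      [set ((Num.sqrt (2 * gamma) / `|u0|) *: u0, 0)]).
Proof.
have neE := nearest_points_CsetE norm_dot.
have ne1 := nearest_points_Cset1 norm_dot.
have n2 : (2 : R) != 0 by rewrite pnatr_eq0.
have nn2 : 1 + 1 = 2 :> R by lra.
split=> [u0n v0n p q|].
  have root_nearest l : -1 < l < 1 /\ Hfun gamma p q l = 0 ->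
      nearest_points (Cset gamma) (u0, v0) =
      [set ((1 + l)^-1 *: u0, (1 - l)^-1 *: v0)].
    move=> [lin Hl]; rewrite -(ne1 _ _ _ _ lin (Hfun_root_Cset lin Hl)).
    by case/andP: lin => l1 l2;
      rewrite !scalerA !divff ?scale1r//; apply/eqP; lra.
  have [||l lin Hl] := @Hfun_root_exists _ gamma (`|u0| ^+ 2) (`|v0| ^+ 2).
  - by rewrite exprn_gt0// normr_gt0.
  - by rewrite exprn_gt0// normr_gt0.
  exists l; split; last exact: root_nearest.
  (* Two roots give the same singleton, and u0 != 0 lets its first component
     recover the multiplier. *)
  split=> // m mP.
  have : [set ((1 + l)^-1 *: u0, (1 - l)^-1 *: v0)]
      ((1 + m)^-1 *: u0, (1 - m)^-1 *: v0).
    by rewrite -root_nearest// (root_nearest m).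
  move=> [/eqP+ _]; rewrite -subr_eq0 -scalerBl scaler_eq0 (negPf u0n) orbF.
  by rewrite subr_eq0 => /eqP /invr_inj /addrI.
split=> [_|].
  have Cu u : Cset gamma (u, 2^-1 *: v0) <->
      `|u| ^+ 2 = 2 * gamma + `|v0| ^+ 2 / 4.
    by rewrite /Cset/= sqr_normZ; split=> ?; lra.
  have nearE (u : X) : `|u| ^+ 2 = 2 * gamma + `|v0| ^+ 2 / 4 ->
      nearest_points (Cset gamma) (0, v0) =
      [set s | Cset gamma s /\ s.2 = 2^-1 *: v0].
    move=> /Cu uC; have := neE gamma (-1) u (2^-1 *: v0).
    rewrite subrr opprK nn2 scale0r scalerA divff// scale1r => -> //; last lra.
    apply/seteqP; split=> s /=.
      move=> [Cs _ /eqP]; rewrite scaler_eq0 (negPf n2) subr_eq0 => /eqP s2.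
      by split.
    by move=> [Cs ->]; rewrite scale0r subrr scaler0.
  apply/seteqP; split=> [s sP|_ [u uE <-]].
    (* A nearest point is on the hyperbola, so its nonzero first component
       can be rescaled to the required norm. *)
    have [u uE] : exists u : X, `|u| ^+ 2 = 2 * gamma + `|v0| ^+ 2 / 4.
      apply: (@exists_sqr_norm _ _ s.1).
        exact: (Cset_fst_neq0 gamma_gt0 sP.1).
      by have := sqr_ge0 `|v0|; lra.
    move: sP; rewrite (nearE u)//; case: s => s1 s2 [+ /= s2E].
    by rewrite s2E => /(Cu s1) s1E; exists s1.
  by rewrite (nearE u)//=; split=> //; apply/Cu.
have sg : 0 < Num.sqrt (2 * gamma) by rewrite sqrtr_gt0; lra.
have sg2 : Num.sqrt (2 * gamma) ^+ 2 = 2 * gamma by rewrite sqr_sqrtr//; lra.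
split=> [_ u0ge|_ /andP[u0gt u0lt]].
  have Cv v : Cset gamma (2^-1 *: u0, v) <->
      `|v| ^+ 2 = `|u0| ^+ 2 / 4 - 2 * gamma.
    by rewrite /Cset/= sqr_normZ; split=> ?; lra.
  have [v vE] : exists v : X, `|v| ^+ 2 = `|u0| ^+ 2 / 4 - 2 * gamma.
    by apply: (@exists_sqr_norm _ _ u0); [rewrite -normr_gt0; lra|nra].
  have := neE gamma 1 (2^-1 *: u0) v.
  rewrite subrr nn2 scale0r scalerA divff// scale1r => ->; [|lra|exact/Cv].
  apply/seteqP; split=> [[s1 s2]/=|_ [w wE <-]/=].
    move=> [+ /eqP + _]; rewrite scaler_eq0 (negPf n2) subr_eq0 => + /eqP s1E.
    by rewrite s1E => /Cv s2E; exists s2.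
  by rewrite subrr scale0r scaler0; split=> //; apply/Cv.
have := ne1 gamma (`|u0| / Num.sqrt (2 * gamma) - 1)
  ((Num.sqrt (2 * gamma) / `|u0|) *: u0) 0.
rewrite addrCA subrr addr0 scaler0 scalerA.
rewrite mulrA divfK ?gt_eqF// divff ?gt_eqF// scale1r => ->//.
- rewrite ltrBDr ltrBlDr addNr nn2 divr_gt0//= ltr_pdivrMr//.
- rewrite /Cset/= sqr_normZ normr0 -exprMn divfK ?gt_eqF// sg2; lra.
Qed.
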